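(* Let $\mathscr{V}$ be a finite set, $F:2^{\mathscr{V}}\to\mathbb{R}$ a non-decreasing set function with $F(\emptyset)=0$, and $q_1,\dots,q_l\ge1$ integers with $k:=\sum_{i=1}^lq_i\le|\mathscr{V}|$. Let $\mathcal{M}_{\uparrow}[\cdot]$ be a modular lower bound for the incremental gains of $F$, and let $\emptyset=\mathscr{A}_0\subset\mathscr{A}_1\subset\dots\subset\mathscr{A}_l=\mathscr{A}$ be the successive sets produced by the greedy algorithm using $\mathcal{M}_{\uparrow}$ with batch sizes $q_1,\dots,q_l$ (for maximizing $F(\mathscr{A})$ subject to $|\mathscr{A}|\le k$). Let $\mathscr{A}^*$ be a maximizer of $F$ over sets of cardinality at most $k$, with $|\mathscr{A}^*|=k$, and for each $i=1,\dots,l$ let $\tau_i>0$ be the smallest scalar satisfying $$\rho_{\mathscr{A}^*}(\mathscr{A}_{i-1})-\mathcal{M}_{\uparrow}\left[\rho_{\mathscr{A}^*}(\mathscr{A}_{i-1})\right]\ \le\ \frac{\tau_i\,k\,\rho_{\mathscr{A}_i}(\mathscr{A}_{i-1})}{q_i}.$$ Then $$F(\mathscr{A})\ \ge\ \left(1-\prod_{i=1}^{l}\left(1-\frac{q_i}{k(1+\tau_i)}\right)\right)\max_{\mathscr{B}\subseteq\mathscr{V},\,|\mathscr{B}|\le k}F(\mathscr{B}).$$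
   Context: Incremental gain: $\rho_{\mathscr{A}}(\mathscr{B})=F(\mathscr{A}\cup\mathscr{B})-F(\mathscr{B})$ for $\mathscr{A},\mathscr{B}\subseteq\mathscr{V}$. Modular lower bound: for each $\mathscr{B}\subseteq\mathscr{V}$ there are real weights $w_\nu(\mathscr{B})$, $\nu\in\mathscr{V}\setminus\mathscr{B}$ (possibly negative), such that $\mathcal{M}_{\uparrow}[\rho_{\mathscr{A}}(\mathscr{B})]:=\sum_{\nu\in\mathscr{A}\setminus\mathscr{B}}w_\nu(\mathscr{B})\le\rho_{\mathscr{A}}(\mathscr{B})$ for every $\mathscr{A}\subseteq\mathscr{V}$. Greedy algorithm using modular lower bounds: $\mathscr{A}_0=\emptyset$; for $i=1,\dots,l$, choose $\mathscr{Q}\subseteq\mathscr{V}\setminus\mathscr{A}_{i-1}$ with $|\mathscr{Q}|=q_i$ maximizing $\mathcal{M}_{\uparrow}[\rho_{\mathscr{Q}}(\mathscr{A}_{i-1})]$, and set $\mathscr{A}_i=\mathscr{A}_{i-1}\cup\mathscr{Q}$. Output $\mathscr{A}=\mathscr{A}_l$. *)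

(* Defs.v *)
From HB Require Import structures.
From mathcomp Require Import all_boot all_order all_algebra.
From mathcomp Require Import reals.

Set Implicit Arguments.
Unset Strict Implicit.
Unset Printing Implicit Defensive.

Import Order.TTheory GRing.Theory Num.Theory.
Local Open Scope ring_scope.

Section SetFunctions.
Context {R : realType} {V : finType}.
Implicit Types (F : {set V} -> R) (w : {set V} -> V -> R) (A B Q : {set V}).

Definition nondecreasing_setfun F : Prop :=
  {homo F : A B / A \subset B >-> A <= B}.

(* rho_A(B) *)
Definition gain F A B : R := F (A :|: B) - F B.

(* M[rho_A(B)]; only the weights [w B v] with [v \notin B] are ever used. *)
Definition modular_bound w A B : R := \sum_(v in A :\: B) w B v.

Definition is_modular_lower_bound F w : Prop :=
  forall A B, modular_bound w A B <= gain F A B.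

Definition greedy_batch w B (n : nat) Q : Prop :=
  [/\ Q \subset ~: B,
      #|Q| = n &
      forall Q', Q' \subset ~: B -> #|Q'| = n ->
        modular_bound w Q' B <= modular_bound w Q B].

(* Batch sizes are indexed from 0, so step [i : 'I_l] goes from [A i] to
   [A i.+1]; the values of [A] beyond [l] are irrelevant. *)
Definition greedy_run w (l : nat) (q : 'I_l -> nat) (A : nat -> {set V}) : Prop :=
  A 0%N = set0 /\
  forall i : 'I_l,
    exists2 Q, greedy_batch w (A i) (q i) Q & A i.+1 = A i :|: Q.

Definition is_maximizer F (k : nat) A : Prop :=
  (#|A| <= k)%N /\ forall B, (#|B| <= k)%N -> F B <= F A.

(* [set0] is admissible for every [k], so the initial value [F set0] of the
   iterated maximum does not affect it. *)
Definition max_value F (k : nat) : R :=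
  \big[Num.max/F set0]_(B : {set V} | (#|B| <= k)%N) F B.

Definition smallest_positive (P : R -> Prop) (t : R) : Prop :=
  [/\ 0 < t, P t & forall s : R, 0 < s -> P s -> t <= s].

End SetFunctions.

(* Main.v *)
Require Import Defs.
From HB Require Import structures.
From mathcomp Require Import all_boot all_order all_algebra.
From mathcomp Require Import reals lra.

(** Write [D i = F Astar - F (A i)] for the optimality gap before step [i].
    The heart of the matter is that a greedy batch [Q] at [B], with gain
    [g = gain F Q B], satisfies [n * M(T) <= k * g] for every competitor [T]
    with at most [k] elements, where [n = #|Q|] and [M] is the modular bound.
    With [T = Astar], the defining inequality of [tau i] and monotonicity then
    give

      [D i <= gain F Astar (A i) <= (1 + tau i) * (k / q i) * (D i - D i.+1)],

    that is [D i.+1 <= (1 - q i / (k * (1 + tau i))) * D i].  These factors are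
    nonnegative because [q i <= k], so the contractions multiply up to the
    stated bound, starting from [D 0 = F Astar].

    The comparison of [M(T)] with [g] is usually done by averaging: the batch
    beats the [n] heaviest elements of [T].  This breaks down when [T] has
    fewer than [n] elements outside [B], since padding it may bring in negative
    weights.  Instead let [c] be the least weight in [Q]; by an exchange
    argument ([greedy_batch_exchange]) no element outside [B] and [Q] weighs more
    than [c].
    - If [c >= 0], counting elements on both sides of the threshold [c] compares
      [M(T)] with [M(Q) <= g] ([threshold_sum_le]).
    - If [c <= 0], dropping the elements of [T] outside [Q] can only increase
      [M(T)], and what remains is a subset of [Q], whose modular bound is at most
      its gain and hence at most [g] by monotonicity; now use [n <= k] and [g >= 0]
      ([greedy_batch_modular_bound_le]). *)

Set Implicit Arguments.
Unset Strict Implicit.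
Unset Printing Implicit Defensive.

Import Order.TTheory GRing.Theory Num.Theory.
Local Open Scope ring_scope.

(** Replacing every weight by [c] can only shrink the difference of the two
    sides: on [T :\: Q] and [Q :\: T] by the threshold hypotheses, and on
    [T :&: Q] because there the weights are at least [c] and count with the
    coefficient [k - #|Q| >= 0].  What is left is [#|Q| * (k - #|T|) * c >= 0]. *)
Lemma threshold_sum_le (R : realType) (V : finType) (u : V -> R)
    (T Q : {set V}) (k : nat) (c : R) :
  0 <= c -> (#|T| <= k)%N -> (#|Q| <= k)%N ->
  (forall v, v \in T :\: Q -> u v <= c) -> (forall x, x \in Q -> c <= u x) ->
  #|Q|%:R * \sum_(v in T) u v <= k%:R * \sum_(v in Q) u v.
Proof.
move=> c0 Tk Qk Tc Qc.
have sum_ge (S : {set V}) : S \subset Q -> #|S|%:R * c <= \sum_(v in S) u v.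
  move=> /subsetP SQ; rewrite mulr_natl -sumr_const.
  by apply: ler_sum => v /SQ; apply: Qc.
have sTD : \sum_(v in T :\: Q) u v <= #|T :\: Q|%:R * c.
  by rewrite mulr_natl -sumr_const; apply: ler_sum.
have sI := sum_ge _ (subsetIr T Q).
have sQD := sum_ge _ (subsetDl Q T).
rewrite (big_setID Q) /= [in leRHS](big_setID T) /= [Q :&: T]setIC.
move: Tk Qk; rewrite -!(ler_nat R) -(cardsID Q T) -(cardsID T Q) [Q :&: T]setIC.
rewrite !natrD.
have := ler0n R #|T :&: Q|; have := ler0n R #|Q :\: T|.
move: sTD sI sQD.
move: (\sum_(v in T :\: Q) u v) (\sum_(v in T :&: Q) u v)
  (\sum_(v in Q :\: T) u v) => td ti qd.
move: (#|T :&: Q|%:R : R) (#|T :\: Q|%:R : R) (#|Q :\: T|%:R : R) (k%:R : R).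
move=> s a b K h1 h2 h3 b0 s0 Tk Qk.
have K0 : 0 <= K by lra.
have e1 : 0 <= (s + b) * (a * c - td) by apply: mulr_ge0; lra.
have e2 : 0 <= (K - (s + b)) * (ti - s * c) by apply: mulr_ge0; lra.
have e3 : 0 <= K * (qd - b * c) by apply: mulr_ge0; lra.
have e4 : 0 <= ((s + b) * (K - (s + a))) * c by do ?apply: mulr_ge0; lra.
lra.
Qed.

Lemma gain_homo (R : realType) (V : finType) (F : {set V} -> R) (B : {set V}) :
  nondecreasing_setfun F -> {homo gain F ^~ B : A A' / A \subset A' >-> A <= A'}.
Proof. by move=> hF A A' AA'; rewrite lerD2r; apply/hF/setSU. Qed.

Lemma gain_ge0 (R : realType) (V : finType) (F : {set V} -> R) (A B : {set V}) :
  nondecreasing_setfun F -> 0 <= gain F A B.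
Proof. by move=> hF; rewrite subr_ge0; apply/hF/subsetUr. Qed.

Lemma modular_bound_disjoint (R : realType) (V : finType)
    (w : {set V} -> V -> R) (A B : {set V}) :
  A \subset ~: B -> modular_bound w A B = \sum_(v in A) w B v.
Proof. by move=> AB; rewrite /modular_bound setDE (setIidPl AB). Qed.

(** Swapping [x] for [v] would otherwise give a heavier batch. *)
Lemma greedy_batch_exchange (R : realType) (V : finType)
    (w : {set V} -> V -> R) (B : {set V}) (n : nat) (Q : {set V}) (v x : V) :
  greedy_batch w B n Q -> v \notin B -> v \notin Q -> x \in Q ->
  w B v <= w B x.
Proof.
move=> [QB cQ hQ] vB vQ xQ.
have vQx : v \notin Q :\ x by rewrite !inE (negbTE vQ) andbF.
have Q'B : v |: Q :\ x \subset ~: B.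
  by rewrite subUset sub1set inE vB (subset_trans (subsetDl _ _) QB).
have cQ' : #|v |: Q :\ x| = n.
  by rewrite cardsU1 vQx -cQ (cardsD1 x Q) xQ.
have := hQ _ Q'B cQ'.
by rewrite !modular_bound_disjoint // big_setU1 //= (big_setD1 x xQ) /= lerD2r.
Qed.

(** Replaces the averaging bound, which needs [n <= #|T :\: B|].  The price is
    that monotonicity of [F] enters, through the batches that contain elements
    of nonpositive weight. *)
Lemma greedy_batch_modular_bound_le (R : realType) (V : finType)
    (F : {set V} -> R) (w : {set V} -> V -> R) (B Q T : {set V}) (n k : nat) :
  nondecreasing_setfun F -> is_modular_lower_bound F w ->
  greedy_batch w B n Q -> (0 < n <= k)%N -> (#|T| <= k)%N ->
  n%:R * modular_bound w T B <= k%:R * gain F Q B.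
Proof.
move=> hF hw gQ /andP[n0 nk] Tk; have [QB cQ _] := gQ.
have [x0 x0Q] : exists x, x \in Q by apply/card_gt0P; rewrite cQ.
case: (arg_minP (w B) x0Q) => x xQ xmin.
have Tx v : v \in (T :\: B) :\: Q -> w B v <= w B x.
  by rewrite !inE => /and3P[vQ vB _]; apply: greedy_batch_exchange gQ _ _ xQ.
have [c0|/ltW c0] := leP 0 (w B x).
  apply: (@le_trans _ _ (k%:R * modular_bound w Q B)); last first.
    by rewrite ler_wpM2l.
  rewrite (modular_bound_disjoint _ QB) -cQ.
  apply: threshold_sum_le c0 _ _ Tx xmin; last by rewrite cQ.
  exact: leq_trans (subset_leq_card (subsetDl _ _)) Tk.
have MTg : modular_bound w T B <= gain F Q B.
  apply: (@le_trans _ _ (modular_bound w (T :&: Q) B)); last first.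
    by apply: le_trans (hw _ _) _; apply: gain_homo (subsetIr _ _).
  rewrite /modular_bound (big_setID Q) /= setIDAC gerDl.
  by apply: sumr_le0 => v /Tx /le_trans; apply.
apply: (@le_trans _ _ (n%:R * gain F Q B)); first by rewrite ler_wpM2l.
by rewrite ler_wpM2r ?ler_nat // gain_ge0.
Qed.

Lemma max_value_maximizer (R : realType) (V : finType) (F : {set V} -> R)
    (k : nat) (A : {set V}) :
  is_maximizer F k A -> max_value F k = F A.
Proof.
move=> [Ak Amax]; apply/le_anti/andP; split; last exact: le_bigmax_cond.
by apply/bigmax_leP; split=> [|B Bk]; apply: Amax; rewrite ?cards0.
Qed.

Lemma prod_contraction (R : realType) (l : nat) (c : 'I_l -> R) (D : nat -> R) :
  (forall i, 0 <= c i) -> (forall i : 'I_l, D i.+1 <= c i * D i) ->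
  D l <= (\prod_(i < l) c i) * D 0%N.
Proof.
elim: l c => [|l IHl] c c0 hD; first by rewrite big_ord0 mul1r.
rewrite big_ord_recr /= mulrAC mulrC.
apply: le_trans (hD ord_max) _; rewrite ler_wpM2l //.
by apply: IHl => i; [exact: c0 | exact: (hD (widen_ord _ i))].
Qed.

(** Here [p], [t] and [K] stand for a batch size, a [tau i] and the total
    budget, and [d] and [d'] for the gaps before and after the step. *)
Lemma gap_step (R : realType) (p t K d d' : R) :
  0 < p -> 0 < t -> 0 < K ->
  p * d <= (1 + t) * K * (d - d') -> d' <= (1 - p / (K * (1 + t))) * d.
Proof.
move=> p0 t0 K0 h; have P0 : 0 < K * (1 + t) by apply: mulr_gt0; lra.
rewrite mulrBl mul1r mulrAC -subr_ge0 addrAC subr_ge0 ler_pdivrMr //.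
lra.
Qed.

Theorem theorem4p1 (R : realType) (V : finType) (F : {set V} -> R)
  (hmono : nondecreasing_setfun F) (hF0 : F set0 = 0)
  (l : nat) (q : 'I_l -> nat) (hq : forall i, (1 <= q i)%N)
  (k : nat) (hk : k = (\sum_(i < l) q i)%N) (hkV : (k <= #|V|)%N)
  (w : {set V} -> V -> R) (hw : is_modular_lower_bound F w)
  (A : nat -> {set V}) (hA : greedy_run w q A)
  (Astar : {set V}) (hAstar : is_maximizer F k Astar) (hcard : #|Astar| = k)
  (tau : 'I_l -> R)
  (htau : forall i : 'I_l,
    smallest_positive
      (fun t : R =>
         gain F Astar (A i) - modular_bound w Astar (A i)
         <= t * k%:R * gain F (A i.+1) (A i) / (q i)%:R)
      (tau i)) :
  F (A l) >=
  (1 - \prod_(i < l) (1 - (q i)%:R / (k%:R * (1 + tau i)))) * max_value F k.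
Proof.
have [A0 hstep] := hA.
have qk i : (0 < q i <= k)%N by rewrite hq hk (bigD1 i) //= leq_addr.
have posq i : 0 < (q i)%:R :> R by rewrite ltr0n hq.
have posk n : (0 < n <= k)%N -> 0 < k%:R :> R.
  by rewrite ltr0n => /andP[]; apply: leq_trans.
have tau0 i : 0 < tau i by case: (htau i).
rewrite (max_value_maximizer hAstar).
suff gap : F Astar - F (A l) <=
    (\prod_(i < l) (1 - (q i)%:R / (k%:R * (1 + tau i)))) * F Astar.
  by rewrite mulrBl mul1r lerBlDr -lerBlDl.
have -> : \prod_(i < l) (1 - (q i)%:R / (k%:R * (1 + tau i))) * F Astar =
    \prod_(i < l) (1 - (q i)%:R / (k%:R * (1 + tau i))) * (F Astar - F (A 0%N)).
  by rewrite A0 hF0 subr0.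
apply: (@prod_contraction _ _ _ (fun i => F Astar - F (A i))) => i.
  have posd : 0 < k%:R * (1 + tau i) by rewrite mulr_gt0 ?(posk _ (qk i)) ?addr_gt0.
  rewrite subr_ge0 ler_pdivrMr // mul1r (@le_trans _ _ k%:R) //.
    by rewrite ler_nat; case/andP: (qk i).
  by rewrite ler_peMr // lerDl ltW.
have [Q gQ AQ] := hstep i.
apply: gap_step => //; first exact: posk (qk i).
have gainS : gain F (A i.+1) (A i) = F (A i.+1) - F (A i).
  by rewrite /gain AQ setUAC setUid.
have gainQ : gain F Q (A i) = F (A i.+1) - F (A i) by rewrite /gain AQ setUC.
have Mle : (q i)%:R * modular_bound w Astar (A i) <=
    k%:R * (F (A i.+1) - F (A i)).
  by rewrite -gainQ; apply: greedy_batch_modular_bound_le gQ _ _; rewrite ?hcard.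
have [_ + _] := htau i; rewrite ler_pdivlMr // gainS => htau_i.
have gap_gain : F Astar - F (A i) <= gain F Astar (A i).
  by rewrite lerD2r; apply/hmono/subsetUl.
have : (q i)%:R * (F Astar - F (A i)) <= (q i)%:R * gain F Astar (A i).
  by rewrite ler_wpM2l.
by move: Mle htau_i; lra.
Qed.
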